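(* Let $|q|<1$. Then $$5\sum_{n=1}^\infty\frac{(q;q)_{n-1}^2q^n}{(-q;q)_n^2}-4\sum_{n=1}^\infty\frac{(q;q)_{n-1}^2q^n}{(-q;q)_n^2}\left(\sum_{k=1}^{n-1}\frac{q^k(5+6q^k+5q^{2k})}{(1-q^{2k})^2}+\frac{q^n}{(1+q^n)^2}\right)$$ $$=\frac{(q;q)_\infty^2}{(-q;q)_\infty^2}\left\{3\sum_{n=1}^\infty\frac{nq^n}{1-q^n}+2\sum_{n=1}^\infty\frac{(2n-1)q^{2n-1}}{1-q^{2n-1}}\right\}.$$
   Context: For $A\in\mathbb{C}$ and $|q|<1$: $(A;q)_n=\prod_{j=1}^{n}(1-Aq^{j-1})$ for integers $n\ge 0$ (so $(A;q)_0=1$), and $(A;q)_\infty=\lim_{n\to\infty}(A;q)_n$. *)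

(* Defs.v *)
From Stdlib Require Export Reals.
From Coquelicot Require Export Coquelicot.

Open Scope C_scope.

(* (A;q)_n; the factor with index j in the usual product is added at step
   m = j - 1. *)
Fixpoint qpoch (A q : C) (n : nat) : C :=
  match n with
  | O => 1
  | S m => qpoch A q m * (1 - A * q ^ m)
  end.

(* Total operators on C, built with [iota] as Coquelicot's [RInt] is: the
   result is meaningful only when the limit, resp. the sum, exists. *)
Definition C_lim_seq (u : nat -> C) : C :=
  iota (T := C_CompleteNormedModule)
    (fun l => filterlim u eventually (locally l)).

Definition qpoch_inf (A q : C) : C := C_lim_seq (qpoch A q).

(* Series whose first index is n = 1; the value [a 0] is not used. *)
Definition is_series1 (a : nat -> C) (l : C) : Prop :=
  is_series (V := C_CompleteNormedModule) (fun m => a (S m)) l.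

Definition ex_series1 (a : nat -> C) : Prop :=
  exists l : C, is_series1 a l.

Definition Series1 (a : nat -> C) : C :=
  iota (T := C_CompleteNormedModule) (is_series1 a).

Lemma C_lim_seq_unique (u : nat -> C) (l : C) :
  filterlim u eventually (locally (l : C_CompleteNormedModule)) ->
  C_lim_seq u = l.
Proof.
  exact (iota_filterlim_locally (V := C_CompleteNormedModule) u l).
Qed.

Lemma is_series1_unique (a : nat -> C) (l : C) :
  is_series1 a l -> Series1 a = l.
Proof.
  exact (iota_filterlim_locally (V := C_CompleteNormedModule)
           (sum_n (fun m => a (S m))) l).
Qed.

(* (q;q)_{n-1}^2 q^n / (-q;q)_n^2, for n >= 1. *)
Definition weight (q : C) (n : nat) : C :=
  qpoch q q (n - 1) ^ 2 * q ^ n / qpoch (- q) q n ^ 2.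

(* For n = 1 the finite sum is empty: [sum_n_m a 1 0] is zero. *)
Definition inner_sum (q : C) (n : nat) : C :=
  sum_n_m
    (fun k => q ^ k * (5 + 6 * q ^ k + 5 * q ^ (2 * k))
              / (1 - q ^ (2 * k)) ^ 2)
    1 (n - 1)
  + q ^ n / (1 + q ^ n) ^ 2.

(* Main.v *)
(* Put P_n = (q;q)_n^2 / (-q;q)_n^2 and let I_n be the sum over 1 <= k <= n of
   4 q^k / (1 - q^k)^2 + q^k / (1 + q^k)^2. By partial fractions the bracket of
   the n-th term is I_(n-1) + q^n / (1 + q^n)^2, and 5 - 4 * bracket times the
   n-th weight is exactly P_n I_n - P_(n-1) I_(n-1), so the left-hand side is
   the limit of P_n I_n. The Lambert series identity
     sum_k s q^k / (1 - s q^k)^2 = sum_n n s^n q^n / (1 - q^n),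
   whose right-hand side is called L(s), gives 4 L(1) - L(-1) for the limit of
   I_n. Half of L(1) - L(-1) is the series over odd indices, so this limit is
   3 times the full series plus 2 times the odd one. *)
Require Import Defs.
From Stdlib Require Import Reals Lra Lia.
From Coquelicot Require Import Coquelicot.

Open Scope C_scope.

(** * Limits of complex sequences, reduced to real ones *)

(** Encoded as a real limit so that squeezing, sums, products and subsequences come from the real
    theory; [C_cv_filterlim] links it to the filter form behind [C_lim_seq] and [is_series1]. *)
Definition C_cv (u : nat -> C) (l : C) : Prop :=
  is_lim_seq (fun n => Cmod (u n - l)) 0%R.

Lemma C_cv_filterlim (u : nat -> C) (l : C) :
  C_cv u l <->
  filterlim u eventually (locally (l : C_CompleteNormedModule)).
Proof.
  rewrite (filterlim_locally_ball_norm (U := C_CompleteNormedModule) u l).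
  unfold C_cv. rewrite <- is_lim_seq_spec. unfold is_lim_seq'.
  split; intros H eps; destruct (H eps) as [N HN]; exists N; intros n Hn;
    specialize (HN n Hn); unfold ball_norm in *;
    change (norm (minus (u n) l)) with (Cmod (u n - l)) in *;
    rewrite Rminus_0_r, Rabs_pos_eq in * by apply Cmod_ge_0; exact HN.
Qed.

Lemma C_cv_le (u : nat -> C) (l : C) (e : nat -> R) :
  (forall n, (Cmod (u n - l) <= e n)%R) -> is_lim_seq e 0%R -> C_cv u l.
Proof.
  intros Hu He. apply is_lim_seq_le_le with (fun _ => 0%R) e; trivial.
  - intros n. split; [apply Cmod_ge_0 | apply Hu].
  - apply is_lim_seq_const.
Qed.

Lemma C_cv_ext (u v : nat -> C) (l : C) :
  (forall n, u n = v n) -> C_cv u l -> C_cv v l.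
Proof.
  intros H. apply is_lim_seq_ext. intros n. now rewrite H.
Qed.

Lemma C_cv_const (c : C) : C_cv (fun _ => c) c.
Proof.
  apply is_lim_seq_ext with (fun _ => 0%R); [|apply is_lim_seq_const].
  intros _. replace (c - c) with (RtoC 0) by ring. now rewrite Cmod_0.
Qed.

Lemma C_cv_incr_1 (u : nat -> C) (l : C) :
  C_cv u l <-> C_cv (fun n => u (S n)) l.
Proof.
  exact (is_lim_seq_incr_1 (fun n => Cmod (u n - l)) 0%R).
Qed.

Lemma C_cv_plus (u v : nat -> C) (l m : C) :
  C_cv u l -> C_cv v m -> C_cv (fun n => u n + v n) (l + m).
Proof.
  intros Hu Hv.
  apply C_cv_le with (fun n => Cmod (u n - l) + Cmod (v n - m))%R.
  - intros n. replace (u n + v n - (l + m)) with ((u n - l) + (v n - m)) by ring.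
    apply Cmod_triangle.
  - replace 0%R with (0 + 0)%R by ring. now apply is_lim_seq_plus'.
Qed.

Lemma C_cv_mult (u v : nat -> C) (l m : C) :
  C_cv u l -> C_cv v m -> C_cv (fun n => u n * v n) (l * m).
Proof.
  intros Hu Hv.
  apply C_cv_le with (fun n => Cmod (u n - l) * Cmod (v n - m)
     + (Cmod l * Cmod (v n - m) + Cmod m * Cmod (u n - l)))%R.
  - intros n.
    replace (u n * v n - l * m)
      with ((u n - l) * (v n - m) + (l * (v n - m) + m * (u n - l))) by ring.
    rewrite <- !Cmod_mult.
    eapply Rle_trans; [apply Cmod_triangle|].
    apply Rplus_le_compat_l, Cmod_triangle.
  - replace 0%R with (0 * 0 + (Cmod l * 0 + Cmod m * 0))%R by ring.
    repeat apply is_lim_seq_plus'.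
    + now apply is_lim_seq_mult'.
    + now apply is_lim_seq_mult'; [apply is_lim_seq_const|].
    + now apply is_lim_seq_mult'; [apply is_lim_seq_const|].
Qed.

Lemma C_cv_scal (c : C) (u : nat -> C) (l : C) :
  C_cv u l -> C_cv (fun n => c * u n) (c * l).
Proof.
  apply (C_cv_mult (fun _ => c)), C_cv_const.
Qed.

Lemma C_cv_minus (u v : nat -> C) (l m : C) :
  C_cv u l -> C_cv v m -> C_cv (fun n => u n - v n) (l - m).
Proof.
  intros Hu Hv.
  apply C_cv_ext with (fun n => u n + - (1) * v n); [intros n; ring|].
  replace (l - m) with (l + - (1) * m) by ring.
  now apply C_cv_plus, C_cv_scal.
Qed.

Lemma C_cv_unique (u : nat -> C) (l m : C) : C_cv u l -> C_cv u m -> l = m.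
Proof.
  intros Hl%C_cv_filterlim%C_lim_seq_unique Hm%C_cv_filterlim%C_lim_seq_unique.
  now rewrite <- Hl.
Qed.

(** * Partial sums starting at index 1 *)

Definition psum (a : nat -> C) (n : nat) : C := sum_n_m a 1 n.

Lemma psum_0 (a : nat -> C) : psum a 0 = 0.
Proof.
  apply (sum_n_m_zero a). lia.
Qed.

Lemma psum_S (a : nat -> C) (n : nat) : psum a (S n) = psum a n + a (S n).
Proof.
  apply (sum_n_Sm a). lia.
Qed.

Lemma is_series1_psum (a : nat -> C) (l : C) :
  is_series1 a l <-> C_cv (psum a) l.
Proof.
  rewrite C_cv_incr_1, C_cv_filterlim. unfold is_series1, is_series, psum.
  split; apply filterlim_ext; intros n; [|symmetry]; apply (sum_n_m_S a 0 n).
Qed.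

Lemma psum_ext (a b : nat -> C) (n : nat) :
  (forall k, a k = b k) -> psum a n = psum b n.
Proof.
  intros H. now apply sum_n_m_ext.
Qed.

Lemma psum_plus (a b : nat -> C) (n : nat) :
  psum (fun k => a k + b k) n = psum a n + psum b n.
Proof.
  exact (sum_n_m_plus a b 1 n).
Qed.

Lemma psum_scal (c : C) (a : nat -> C) (n : nat) :
  psum (fun k => c * a k) n = c * psum a n.
Proof.
  exact (sum_n_m_mult_l (K := C_Ring) c a 1 n).
Qed.

Lemma psum_minus (a b : nat -> C) (n : nat) :
  psum (fun k => a k - b k) n = psum a n - psum b n.
Proof.
  induction n as [|n IH]; [rewrite !psum_0 | rewrite !psum_S, IH]; ring.
Qed.

Lemma psum_switch (u : nat -> nat -> C) (m n : nat) :
  psum (fun i => psum (u i) n) m = psum (fun j => psum (fun i => u i j) m) n.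
Proof.
  induction m as [|m IH].
  - rewrite psum_0. induction n as [|n IHn].
    + now rewrite psum_0.
    + rewrite psum_S, <- IHn, psum_0. ring.
  - rewrite psum_S, IH, <- psum_plus. apply psum_ext. intros k.
    now rewrite psum_S.
Qed.

Lemma Cmod_psum_le (a : nat -> C) (c : R) (n : nat) :
  (forall k, (1 <= k <= n)%nat -> (Cmod (a k) <= c)%R) ->
  (Cmod (psum a n) <= INR n * c)%R.
Proof.
  induction n as [|n IH]; intros H.
  - rewrite psum_0, Cmod_0. simpl. lra.
  - rewrite psum_S, S_INR.
    eapply Rle_trans; [apply Cmod_triangle|].
    assert (Cmod (a (S n)) <= c)%R by (apply H; lia).
    assert (Cmod (psum a n) <= INR n * c)%R by (apply IH; intros; apply H; lia).
    lra.
Qed.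

(** * Geometric domination of series and infinite products *)

Definition geom_bounded (a : nat -> C) : Prop :=
  exists M t : R, (0 <= t < 1)%R /\ forall n, (Cmod (a n) <= M * t ^ n)%R.

Lemma geom_bounded_pow (q : C) :
  (Cmod q < 1)%R -> geom_bounded (fun n => q ^ n).
Proof.
  intros Hq. exists 1%R, (Cmod q). split.
  - split; [apply Cmod_ge_0 | exact Hq].
  - intros n. rewrite Cmod_pow. lra.
Qed.

Lemma geom_bounded_mult (a b : nat -> C) (K : R) :
  (forall n, (Cmod (b n) <= K)%R) ->
  geom_bounded a -> geom_bounded (fun n => a n * b n).
Proof.
  intros Hb (M & t & Ht & Ha). exists (M * K)%R, t. split; [exact Ht|].
  intros n. rewrite Cmod_mult.
  replace (M * K * t ^ n)%R with ((M * t ^ n) * K)%R by ring.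
  apply Rmult_le_compat; auto using Cmod_ge_0.
Qed.

Lemma ex_series1_geom_bounded (a : nat -> C) : geom_bounded a -> ex_series1 a.
Proof.
  intros (M & t & Ht & Ha). red. unfold is_series1.
  apply (ex_series_le (V := C_CompleteNormedModule)
           _ (fun n => M * t * t ^ n)%R).
  - intros n. change (Cmod (a (S n)) <= M * t * t ^ n)%R.
    replace (M * t * t ^ n)%R with (M * t ^ S n)%R by (simpl; ring). apply Ha.
  - apply (ex_series_scal (V := R_NormedModule) (M * t)%R (fun n => t ^ n)%R), ex_series_geom.
    rewrite Rabs_pos_eq; lra.
Qed.

Lemma C_cv_bounded (u : nat -> C) (l : C) :
  C_cv u l -> exists K : R, forall n, (Cmod (u n) <= K)%R.
Proof.
  intros Hu.
  destruct (filterlim_bounded (fun n => Cmod (u n - l))) as [K HK].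
  - exists 0%R. exact Hu.
  - exists (K + Cmod l)%R. intros n.
    replace (u n) with ((u n - l) + l) at 1 by ring.
    eapply Rle_trans; [apply Cmod_triangle|].
    apply Rplus_le_compat_r.
    eapply Rle_trans; [apply Rle_abs | apply HK].
Qed.

(* [1 + x <= exp x] bounds the partial products, so the increments
   [u n * e (S n)] are again geometrically bounded. *)
Lemma ex_C_cv_prod (u e : nat -> C) :
  geom_bounded e -> (forall n, u (S n) = u n * (1 + e (S n))) ->
  exists l, C_cv u l.
Proof.
  intros He Hu.
  assert (Hb : exists K, forall n, (Cmod (u n) <= K)%R).
  { destruct He as (M & t & Ht & He).
    assert (HM : (0 <= M)%R).
    { specialize (He 0%nat). simpl in He.
      pose proof (Cmod_ge_0 (e 0%nat)). lra. }
    (* The exponent is [M] times t + ... + t^n in closed form, so each induction step adds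
       [M * t ^ S n]. *)
    assert (H : forall n, (Cmod (u n) <=
              Cmod (u 0%nat) * exp (M * (t * (1 - t ^ n) / (1 - t))))%R).
    { induction n as [|n IH].
      - simpl. replace (M * (t * (1 - 1) / (1 - t)))%R with 0%R by (field; lra).
        rewrite exp_0. lra.
      - rewrite Hu, Cmod_mult.
        replace (M * (t * (1 - t ^ S n) / (1 - t)))%R
          with (M * (t * (1 - t ^ n) / (1 - t)) + M * t ^ S n)%R
          by (simpl; field; lra).
        rewrite exp_plus, <- Rmult_assoc.
        apply Rmult_le_compat; auto using Cmod_ge_0.
        eapply Rle_trans; [apply Cmod_triangle|]. rewrite Cmod_1.
        eapply Rle_trans; [|apply exp_ineq1_le].
        specialize (He (S n)). lra. }
    exists (Cmod (u 0%nat) * exp (M * (t / (1 - t))))%R. intros n.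
    eapply Rle_trans; [apply H|].
    apply Rmult_le_compat_l; [apply Cmod_ge_0|].
    assert (Hle : (M * (t * (1 - t ^ n) / (1 - t)) <= M * (t / (1 - t)))%R).
    { apply Rmult_le_compat_l; [exact HM|].
      apply Rmult_le_compat_r.
      - apply Rlt_le, Rinv_0_lt_compat. lra.
      - assert (0 <= t * t ^ n)%R by (apply (pow_le t (S n)); lra). lra. }
    destruct Hle as [Hlt | ->]; [|lra]. apply Rlt_le, exp_increasing, Hlt. }
  destruct Hb as [K HK].
  destruct (ex_series1_geom_bounded (fun n => e n * u (n - 1)%nat))
    as [l Hl].
  - now apply geom_bounded_mult with K.
  - exists (u 0%nat + l).
    apply C_cv_ext with (fun n => u 0%nat + psum (fun n => e n * u (n - 1)%nat) n).
    + induction n as [|n IH]; [rewrite psum_0; ring|].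
      rewrite psum_S, Cplus_assoc, IH, Hu.
      replace (S n - 1)%nat with n by lia. ring.
    + apply C_cv_plus; [apply C_cv_const | now apply is_series1_psum].
Qed.

(** * Denominators bounded away from zero *)

(** The parameter [s] lets the cases s = 1 and s = -1, that is the denominators 1 - q^k and 1 + q^k,
    be treated together; the bound is uniform in [k]. *)
Lemma Cmod_scaled_pow_le (q s : C) (k : nat) :
  (Cmod q < 1)%R -> (Cmod s <= 1)%R -> (1 <= k)%nat ->
  (Cmod (s * q ^ k) <= Cmod q)%R.
Proof.
  intros Hq Hs Hk. destruct k as [|k]; [lia|].
  pose proof (Cmod_ge_0 q) as H0.
  assert (Cmod q ^ k <= 1)%R by (rewrite <- (pow1 k); apply pow_incr; lra).
  rewrite Cmod_mult, Cmod_pow. simpl.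
  assert (0 <= Cmod q * Cmod q ^ k)%R by (apply (pow_le _ (S k)), H0).
  pose proof (Cmod_ge_0 s). nra.
Qed.

Lemma Cmod_1_minus_ge (x : C) : (1 - Cmod x <= Cmod (1 - x))%R.
Proof.
  pose proof (Cmod_triangle (1 - x) x) as H.
  replace (1 - x + x) with (RtoC 1) in H by ring. rewrite Cmod_1 in H. lra.
Qed.

Lemma Cmod_1_minus_scaled_pow_ge (q s : C) (k : nat) :
  (Cmod q < 1)%R -> (Cmod s <= 1)%R -> (1 <= k)%nat ->
  (1 - Cmod q <= Cmod (1 - s * q ^ k))%R.
Proof.
  intros Hq Hs Hk.
  pose proof (Cmod_scaled_pow_le q s k Hq Hs Hk).
  pose proof (Cmod_1_minus_ge (s * q ^ k)). lra.
Qed.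

Lemma Cmod_lt_1_minus_neq_0 (x : C) : (Cmod x < 1)%R -> 1 - x <> 0.
Proof.
  intros Hx H. pose proof (Cmod_1_minus_ge x) as Hge.
  rewrite H, Cmod_0 in Hge. lra.
Qed.

Lemma Cmod_div_le (x y : C) (a b : R) :
  (Cmod x <= a)%R -> (0 < b <= Cmod y)%R -> (Cmod (x / y) <= a / b)%R.
Proof.
  intros Hx Hy.
  assert (y <> 0) by (apply Cmod_gt_0; lra).
  rewrite Cmod_div by trivial.
  apply Rmult_le_compat; trivial.
  - apply Cmod_ge_0.
  - apply Rlt_le, Rinv_0_lt_compat. lra.
  - apply Rinv_le_contravar; lra.
Qed.

(** * Decay of polynomial times geometric sequences *)

(** Each of the [n] terms of 1 + t + ... + t^(n-1) is at least t^n, and this sum equals (1 - t^n) /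
    (1 - t). *)
Lemma INR_mult_pow_le (t : R) (n : nat) :
  (0 <= t < 1)%R -> (INR n * t ^ n <= 1 / (1 - t))%R.
Proof.
  intros Ht.
  assert (H : (INR n * t ^ n * (1 - t) <= 1 - t ^ n)%R).
  { induction n as [|n IH]; [simpl; lra|].
    rewrite S_INR. simpl.
    assert (0 <= t ^ n <= 1)%R.
    { split; [apply pow_le; lra|]. rewrite <- (pow1 n). apply pow_incr. lra. }
    assert (t * (INR n * t ^ n * (1 - t)) <= t * (1 - t ^ n))%R
      by (apply Rmult_le_compat_l; lra).
    assert (0 <= (1 - t) * t ^ n)%R by (apply Rmult_le_pos; lra).
    assert (0 <= (1 - t) * (1 - t * t ^ n))%R by (apply Rmult_le_pos; lra).
    lra. }
  apply -> Rle_div_r; [|lra].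
  assert (0 <= t ^ n)%R by (apply pow_le; lra). lra.
Qed.

Lemma geom_bounded_INR_pow (q : C) :
  (Cmod q < 1)%R -> geom_bounded (fun n => INR n * q ^ n).
Proof.
  intros Hq. pose proof (Cmod_ge_0 q) as H0.
  (* Half of the decay absorbs the factor [n]: the modulus is (n t^n) t^n, where the first factor is
     bounded and the second is geometric. *)
  set (t := sqrt (Cmod q)).
  assert (Ht : (0 <= t < 1)%R).
  { split; [apply sqrt_pos|]. rewrite <- sqrt_1. now apply sqrt_lt_1_alt. }
  exists (1 / (1 - t))%R, t. split; [exact Ht|]. intros n.
  rewrite Cmod_mult, Cmod_R, Cmod_pow, Rabs_pos_eq by apply pos_INR.
  replace (Cmod q) with (t * t)%R by now apply sqrt_sqrt.
  rewrite Rpow_mult_distr, <- Rmult_assoc.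
  apply Rmult_le_compat_r; [apply pow_le; lra | now apply INR_mult_pow_le].
Qed.

Lemma geom_bounded_is_lim_seq_0 (a : nat -> C) :
  geom_bounded a -> is_lim_seq (fun n => Cmod (a n)) 0%R.
Proof.
  intros (M & t & Ht & Ha).
  apply is_lim_seq_le_le with (fun _ => 0%R) (fun n => M * t ^ n)%R.
  - intros n. split; [apply Cmod_ge_0 | apply Ha].
  - apply is_lim_seq_const.
  - replace 0%R with (M * 0)%R by ring.
    apply is_lim_seq_mult'; [apply is_lim_seq_const|].
    apply is_lim_seq_geom. rewrite Rabs_pos_eq; lra.
Qed.

(** The sequence is the square of n (sqrt t)^n, which already tends to 0. *)
Lemma is_lim_seq_INR_sqr_pow (t : R) :
  (0 <= t < 1)%R -> is_lim_seq (fun n => INR n * INR n * t ^ n)%R 0%R.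
Proof.
  intros Ht.
  assert (Hs : (0 <= sqrt t < 1)%R).
  { split; [apply sqrt_pos|]. rewrite <- sqrt_1. now apply sqrt_lt_1_alt. }
  assert (H : is_lim_seq (fun n => INR n * sqrt t ^ n)%R 0%R).
  { eapply is_lim_seq_ext;
      [|apply geom_bounded_is_lim_seq_0, (geom_bounded_INR_pow (sqrt t))].
    - intros n. simpl.
      rewrite Cmod_mult, Cmod_pow, !Cmod_R, !Rabs_pos_eq; trivial;
        [apply Hs | apply pos_INR].
    - rewrite Cmod_R, Rabs_pos_eq; apply Hs. }
  replace 0%R with (0 * 0)%R by ring.
  eapply is_lim_seq_ext; [|apply (is_lim_seq_mult' _ _ _ _ H H)].
  intros n. simpl.
  replace (t ^ n)%R with (sqrt t ^ n * sqrt t ^ n)%R; [ring|].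
  rewrite <- Rpow_mult_distr, sqrt_sqrt; lra.
Qed.

(** * The Lambert series identity *)

(** Here and in [psum_arith_geom] the closed form is the full sum minus its tail, because these
    tails are the truncation errors in [C_cv_lambert]. *)
Lemma psum_geom (x : C) (n : nat) :
  1 - x <> 0 -> psum (fun k => x ^ k) n = x / (1 - x) - x ^ S n / (1 - x).
Proof.
  intros Hx. induction n as [|n IH].
  - rewrite psum_0. simpl. field. exact Hx.
  - rewrite psum_S, IH. simpl. field. exact Hx.
Qed.

Lemma psum_arith_geom (x : C) (n : nat) :
  1 - x <> 0 ->
  psum (fun k => INR k * x ^ k) n
  = x / (1 - x) ^ 2 - x ^ S n * (INR n + 1 - INR n * x) / (1 - x) ^ 2.
Proof.
  intros Hx. induction n as [|n IH].
  - rewrite psum_0. simpl. field. exact Hx.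
  - rewrite psum_S, IH, S_INR, RtoC_plus. simpl. field. exact Hx.
Qed.

(* Both sides expand to the double series of [n * (s * q ^ k) ^ n]. Truncated
   to the square [k, n <= N], the two iterated sums agree, and each differs
   from its side by [O (N ^ 2 * Cmod q ^ N)]. *)
Lemma C_cv_lambert (q s l : C) :
  (Cmod q < 1)%R -> (Cmod s <= 1)%R ->
  C_cv (psum (fun n => INR n * s ^ n * q ^ n / (1 - q ^ n))) l ->
  C_cv (psum (fun k => s * q ^ k / (1 - s * q ^ k) ^ 2)) l.
Proof.
  intros Hq Hs Hl. pose proof (Cmod_ge_0 q) as H0.
  set (r := Cmod q) in *.
  assert (Hsq : forall k, (1 <= k)%nat -> (Cmod (s * q ^ k) <= r)%R)
    by (intros; now apply Cmod_scaled_pow_le).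
  assert (Hqk : forall k, (1 <= k)%nat -> (Cmod (q ^ k) <= r)%R).
  { intros k Hk. rewrite <- (Cmult_1_l (q ^ k)).
    apply Cmod_scaled_pow_le; trivial. rewrite Cmod_1. lra. }
  assert (Hpow : forall x N, (Cmod x <= r)%R -> (Cmod (x ^ S N) <= r ^ N)%R).
  { intros x N Hx. rewrite Cmod_pow. simpl.
    assert (Cmod x ^ N <= r ^ N)%R
      by (apply pow_incr; split; [apply Cmod_ge_0 | exact Hx]).
    assert (0 <= Cmod x ^ N)%R by apply pow_le, Cmod_ge_0.
    pose proof (Cmod_ge_0 x). nra. }
  set (a := fun k => s * q ^ k / (1 - s * q ^ k) ^ 2) in *.
  set (b := fun n => INR n * s ^ n * q ^ n / (1 - q ^ n)) in *.
  set (u := fun k n => INR n * (s * q ^ k) ^ n).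
  (* Row error, a tail of the arithmetic-geometric series in x = s q^k. Its factor N + 1 - N x has
     modulus at most 2 N + 1, hence at most 3 N as N >= 1. *)
  assert (Ha : forall N k, (1 <= k <= N)%nat ->
     (Cmod (a k - psum (u k) N) <= 3 * INR N * r ^ N / (1 - r) ^ 2)%R).
  { intros N k Hk. unfold u.
    assert (Hx : (Cmod (s * q ^ k) <= r)%R) by (apply Hsq; lia).
    set (x := s * q ^ k) in *.
    assert (Hx0 : 1 - x <> 0) by (apply Cmod_lt_1_minus_neq_0; lra).
    rewrite psum_arith_geom by trivial. unfold a. fold x.
    replace (x / (1 - x) ^ 2 - (x / (1 - x) ^ 2
              - x ^ S N * (INR N + 1 - INR N * x) / (1 - x) ^ 2))
      with ((x ^ S N * (INR N + 1 - INR N * x)) / (1 - x) ^ 2) by ring.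
    apply Cmod_div_le.
    - rewrite Cmod_mult, Rmult_comm.
      assert (HN : (1 <= INR N)%R) by (apply (le_INR 1); lia).
      apply Rmult_le_compat; auto using Cmod_ge_0.
      replace (INR N + 1 - INR N * x) with (RtoC (INR N + 1) + - (INR N * x))
        by (rewrite RtoC_plus; ring).
      eapply Rle_trans; [apply Cmod_triangle|].
      rewrite Cmod_opp, Cmod_mult, !Cmod_R, !Rabs_pos_eq by lra.
      pose proof (Cmod_ge_0 x). nra.
    - rewrite Cmod_pow. split; [apply pow_lt; lra|].
      apply pow_incr. pose proof (Cmod_1_minus_ge x). lra. }
  (* Column error, a tail of the geometric series with ratio q^n, scaled by n s^n, whose modulus is
     at most N. *)
  assert (Hb : forall N n, (1 <= n <= N)%nat ->
     (Cmod (b n - psum (fun k => u k n) N) <= INR N * r ^ N / (1 - r))%R).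
  { intros N n Hn. unfold u.
    assert (Hw : (Cmod (q ^ n) <= r)%R) by (apply Hqk; lia).
    rewrite (psum_ext _ (fun k => INR n * s ^ n * (q ^ n) ^ k)), psum_scal.
    2: { intros k. rewrite Cpow_mult_l, <- !Cpow_mult_r, (Nat.mul_comm n). ring. }
    unfold b. set (w := q ^ n) in *.
    assert (Hw0 : 1 - w <> 0) by (apply Cmod_lt_1_minus_neq_0; lra).
    rewrite psum_geom by trivial.
    replace (INR n * s ^ n * w / (1 - w)
             - INR n * s ^ n * (w / (1 - w) - w ^ S N / (1 - w)))
      with (INR n * s ^ n * w ^ S N / (1 - w)) by (field; trivial).
    apply Cmod_div_le.
    - rewrite Cmod_mult.
      apply Rmult_le_compat; auto using Cmod_ge_0.
      rewrite Cmod_mult, Cmod_R, Cmod_pow, Rabs_pos_eq by apply pos_INR.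
      assert (INR n <= INR N)%R by (apply le_INR; lia).
      assert (Cmod s ^ n <= 1)%R.
      { rewrite <- (pow1 n). apply pow_incr. split; [apply Cmod_ge_0 | exact Hs]. }
      assert (0 <= Cmod s ^ n)%R by apply pow_le, Cmod_ge_0.
      pose proof (pos_INR n). nra.
    - pose proof (Cmod_1_minus_ge w). lra. }
  apply C_cv_ext with (fun N => psum b N + (psum a N - psum b N));
    [intros N; ring|].
  replace l with (l + 0) by ring. apply C_cv_plus; [exact Hl|].
  (* Adding up [N] row errors and [N] column errors gives the second factor [INR N]. *)
  apply C_cv_le with (fun N =>
    (3 / (1 - r) ^ 2 + 1 / (1 - r)) * (INR N * INR N * r ^ N))%R.
  - intros N.
    replace (psum a N - psum b N - 0)
      with (psum (fun k => a k - psum (u k) N) N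
            + - psum (fun n => b n - psum (fun k => u k n) N) N).
    2: { rewrite !psum_minus, (psum_switch u). ring. }
    eapply Rle_trans; [apply Cmod_triangle|]. rewrite Cmod_opp.
    replace ((3 / (1 - r) ^ 2 + 1 / (1 - r)) * (INR N * INR N * r ^ N))%R
      with (INR N * (3 * INR N * r ^ N / (1 - r) ^ 2)
            + INR N * (INR N * r ^ N / (1 - r)))%R by (field; lra).
    apply Rplus_le_compat; apply Cmod_psum_le; auto.
  - replace 0%R with ((3 / (1 - r) ^ 2 + 1 / (1 - r)) * 0)%R by ring.
    apply is_lim_seq_mult'; [apply is_lim_seq_const|].
    apply is_lim_seq_INR_sqr_pow. lra.
Qed.

(** * Limits of the q-Pochhammer products and their reciprocals *)

(** Index 0 has its own entry in the maximum: for s = 1 the denominator vanishes there and the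
    reciprocal is a default value. The bound then fits [geom_bounded], which ranges over all
    indices. *)
Lemma inv_1_minus_scaled_pow_bounded (q s : C) :
  (Cmod q < 1)%R -> (Cmod s <= 1)%R ->
  exists K : R, forall n, (Cmod (/ (1 - s * q ^ n)) <= K)%R.
Proof.
  intros Hq Hs.
  exists (Rmax (Cmod (/ (1 - s * q ^ 0))) (1 / (1 - Cmod q))). intros [|n].
  - apply Rmax_l.
  - eapply Rle_trans; [|apply Rmax_r].
    rewrite <- (Cmult_1_l (/ _)).
    apply (Cmod_div_le 1); [rewrite Cmod_1; lra|].
    split; [lra|]. apply Cmod_1_minus_scaled_pow_ge; trivial. lia.
Qed.

Lemma one_minus_scaled_pow_neq_0 (q s : C) (k : nat) :
  (Cmod q < 1)%R -> (Cmod s <= 1)%R -> (1 <= k)%nat -> 1 - s * q ^ k <> 0.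
Proof.
  intros Hq Hs Hk. apply Cmod_lt_1_minus_neq_0.
  pose proof (Cmod_scaled_pow_le q s k Hq Hs Hk). lra.
Qed.

(** With parameter [s * q] the factor added at step [m] is 1 - s q^(m+1), so the exponent is never
    0. *)
Lemma qpoch_neq_0 (q s : C) (n : nat) :
  (Cmod q < 1)%R -> (Cmod s <= 1)%R -> qpoch (s * q) q n <> 0.
Proof.
  intros Hq Hs. induction n as [|n IH]; simpl; [exact C1_nz|].
  apply Cmult_neq_0; [exact IH|]. rewrite <- Cmult_assoc.
  apply (one_minus_scaled_pow_neq_0 q s (S n)); trivial. lia.
Qed.

(* The reciprocals are also partial products with geometrically bounded
   increments, so they converge too, which makes the limit nonzero. *)
Lemma qpoch_cv (q s : C) :
  (Cmod q < 1)%R -> (Cmod s <= 1)%R ->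
  exists l : C, l <> 0 /\ C_cv (qpoch (s * q) q) l /\
    C_cv (fun n => / qpoch (s * q) q n) (/ l).
Proof.
  intros Hq Hs.
  destruct (inv_1_minus_scaled_pow_bounded q s Hq Hs) as [K HK].
  destruct (ex_C_cv_prod (qpoch (s * q) q) (fun n => q ^ n * - s)) as [l Hl].
  { apply geom_bounded_mult with 1%R; [|now apply geom_bounded_pow].
    intros _. now rewrite Cmod_opp. }
  { intros n. simpl. ring. }
  (* The increment comes from 1 / (1 - x) = 1 + x / (1 - x) with x = s q^n. *)
  destruct (ex_C_cv_prod (fun n => / qpoch (s * q) q n)
              (fun n => q ^ n * (s * / (1 - s * q ^ n)))) as [m Hm].
  { apply geom_bounded_mult with (1 * K)%R; [|now apply geom_bounded_pow].
    intros n. rewrite Cmod_mult.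
    apply Rmult_le_compat; auto using Cmod_ge_0. }
  { intros n.
    pose proof (qpoch_neq_0 q s n Hq Hs) as H1.
    pose proof (one_minus_scaled_pow_neq_0 q s (S n) Hq Hs) as H2.
    simpl in *. field. repeat split; trivial; intros H; apply H2; try lia.
    rewrite <- H. ring. }
  assert (Hlm : l * m = 1).
  { apply C_cv_unique with (fun _ => RtoC 1); [|apply C_cv_const].
    apply C_cv_ext with (fun n => qpoch (s * q) q n * / qpoch (s * q) q n).
    - intros n. now apply Cinv_r, qpoch_neq_0.
    - now apply C_cv_mult. }
  assert (Hl0 : l <> 0).
  { intros ->. rewrite Cmult_0_l in Hlm. now apply C1_nz. }
  exists l. split; [exact Hl0|]. split; [exact Hl|].
  replace (/ l) with m; [exact Hm|].
  rewrite <- (Cmult_1_l m), <- (Cinv_l l Hl0), <- Cmult_assoc, Hlm. ring.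
Qed.

(** * Telescoping of the left-hand side *)

(** This is P_n, and [full_sum] below is I_n. *)
Definition qpoch_ratio (q : C) (n : nat) : C :=
  qpoch q q n ^ 2 / qpoch (- q) q n ^ 2.

Definition full_sum (q : C) (n : nat) : C :=
  psum (fun k => 4 * (q ^ k / (1 - q ^ k) ^ 2) + q ^ k / (1 + q ^ k) ^ 2) n.

Lemma one_minus_pow_neq_0 (q : C) (k : nat) :
  (Cmod q < 1)%R -> (1 <= k)%nat -> 1 - q ^ k <> 0.
Proof.
  intros Hq Hk. rewrite <- (Cmult_1_l (q ^ k)).
  apply one_minus_scaled_pow_neq_0; trivial. rewrite Cmod_1. lra.
Qed.

Lemma one_plus_pow_neq_0 (q : C) (k : nat) :
  (Cmod q < 1)%R -> (1 <= k)%nat -> 1 + q ^ k <> 0.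
Proof.
  intros Hq Hk. replace (1 + q ^ k) with (1 - - (1) * q ^ k) by ring.
  apply one_minus_scaled_pow_neq_0; trivial. rewrite Cmod_m1. lra.
Qed.

(** With y = q^k this rests on 4 (1 + y)^2 + (1 - y)^2 = 5 + 6 y + 5 y^2. *)
Lemma inner_sum_full_sum (q : C) (n : nat) :
  (Cmod q < 1)%R ->
  inner_sum q n = full_sum q (n - 1) + q ^ n / (1 + q ^ n) ^ 2.
Proof.
  intros Hq. unfold inner_sum, full_sum, psum. f_equal.
  apply sum_n_m_ext_loc. intros k Hk.
  pose proof (one_minus_pow_neq_0 q k Hq (proj1 Hk)) as H1.
  pose proof (one_plus_pow_neq_0 q k Hq (proj1 Hk)) as H2.
  rewrite (Nat.mul_comm 2), Cpow_mult_r.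
  set (y := q ^ k) in *.
  match goal with |- ?a = ?b => change (@eq C a b) end.
  field. repeat split; trivial.
  replace (1 - y ^ 2) with ((1 - y) * (1 + y)) by ring.
  now apply Cmult_neq_0.
Qed.

(** Let y = q^n and let w be the n-th weight, which is P_(n-1) y / (1 + y)^2. From (1 - y)^2 / (1 +
    y)^2 = 1 - 4 y / (1 + y)^2 one gets P_n - P_(n-1) = -4 w, the coefficient of I_(n-1). The new
    term of I_n, multiplied by P_n, gives w (4 + (1 - y)^2 / (1 + y)^2) = w (5 - 4 y / (1 +
    y)^2). *)
Lemma psum_weight_telescope (q : C) (n : nat) :
  (Cmod q < 1)%R ->
  5 * psum (weight q) n - 4 * psum (fun k => weight q k * inner_sum q k) n
  = qpoch_ratio q n * full_sum q n.
Proof.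
  intros Hq. induction n as [|n IH].
  - unfold full_sum. rewrite !psum_0. ring.
  - replace (5 * psum (weight q) (S n)
             - 4 * psum (fun k => weight q k * inner_sum q k) (S n))
      with (qpoch_ratio q n * full_sum q n
            + (5 * weight q (S n) - 4 * (weight q (S n) * inner_sum q (S n))))
      by (rewrite <- IH, !psum_S; ring).
    rewrite inner_sum_full_sum by trivial.
    replace (full_sum q (S n))
      with (full_sum q n + (4 * (q ^ S n / (1 - q ^ S n) ^ 2)
                            + q ^ S n / (1 + q ^ S n) ^ 2))
      by (unfold full_sum; now rewrite psum_S).
    unfold weight, qpoch_ratio.
    replace (S n - 1)%nat with n by lia.
    pose proof (one_minus_pow_neq_0 q (S n) Hq) as H1.
    pose proof (one_plus_pow_neq_0 q (S n) Hq) as H2.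
    assert (H3 : qpoch (- q) q n <> 0).
    { replace (- q) with (- (1) * q) by ring. apply qpoch_neq_0; trivial.
      rewrite Cmod_m1. lra. }
    change (qpoch q q (S n)) with (qpoch q q n * (1 - q * q ^ n)).
    change (qpoch (- q) q (S n)) with (qpoch (- q) q n * (1 - - q * q ^ n)).
    change (q * q ^ n) with (q ^ S n).
    replace (- q * q ^ n) with (- q ^ S n) by (simpl; ring).
    specialize (H1 ltac:(lia)). specialize (H2 ltac:(lia)).
    generalize dependent (q ^ S n). intros y H1 H2.
    field. now repeat split.
Qed.

(** * Convergence of the Lambert series and its odd part *)

Lemma geom_bounded_lambert (q s : C) :
  (Cmod q < 1)%R -> (Cmod s <= 1)%R ->
  geom_bounded (fun n => INR n * s ^ n * q ^ n / (1 - q ^ n)).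
Proof.
  intros Hq Hs.
  destruct (inv_1_minus_scaled_pow_bounded q 1 Hq) as [K HK];
    [rewrite Cmod_1; lra|].
  destruct (geom_bounded_mult (fun n => INR n * q ^ n)
             (fun n => s ^ n * / (1 - 1 * q ^ n)) (1 * K)) as (M & t & Ht & H).
  - intros n. rewrite Cmod_mult. apply Rmult_le_compat; auto using Cmod_ge_0.
    rewrite Cmod_pow, <- (pow1 n). apply pow_incr.
    split; [apply Cmod_ge_0 | exact Hs].
  - now apply geom_bounded_INR_pow.
  - exists M, t. split; [exact Ht|]. intros n. specialize (H n).
    rewrite Cmult_1_l in H.
    replace (INR n * s ^ n * q ^ n / (1 - q ^ n))
      with (INR n * q ^ n * (s ^ n * / (1 - q ^ n))); [exact H|].
    unfold Cdiv. ring.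
Qed.

(** Subtracting the alternating series doubles the odd terms and cancels the even ones. Half the
    difference of the partial sums up to 2 n is thus the n-th partial sum over odd indices, and a
    subsequence keeps the limit. *)
Lemma is_series1_odd (a : nat -> C) (l m : C) :
  is_series1 a l -> is_series1 (fun n => (- (1)) ^ n * a n) m ->
  is_series1 (fun n => a (2 * n - 1)%nat) ((l - m) / 2).
Proof.
  rewrite !is_series1_psum. intros Hl Hm.
  assert (H := C_cv_minus _ _ _ _ Hl Hm).
  apply C_cv_ext with (fun n => / 2 * (psum a (2 * n)
     - psum (fun n => (- (1)) ^ n * a n) (2 * n))).
  - induction n as [|n IH].
    + simpl. rewrite !psum_0. ring.
    + rewrite psum_S, <- IH.
      replace (2 * S n)%nat with (S (S (2 * n))) by lia.
      rewrite !psum_S.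
      replace (S (S (2 * n)) - 1)%nat with (S (2 * n)) by lia.
      rewrite !Cpow_S, Cpow_mult_r.
      replace ((- (1)) ^ 2) with (RtoC 1) by ring. rewrite Cpow_1_l.
      field.
  - unfold Cdiv. rewrite (Cmult_comm (l - m)). apply C_cv_scal.
    apply (is_lim_seq_subseq _ 0%R (fun n => (2 * n)%nat)) in H; [exact H|].
    apply eventually_subseq. intros n. lia.
Qed.

(** * Summability and passage to the limit *)

Theorem theorem1p7 :
  forall q : C, (Cmod q < 1)%R ->
  ex_series1 (fun n => weight q n) /\
  ex_series1 (fun n => weight q n * inner_sum q n) /\
  ex_series1 (fun n => INR n * q ^ n / (1 - q ^ n)) /\
  ex_series1 (fun n => INR (2 * n - 1) * q ^ (2 * n - 1)
                       / (1 - q ^ (2 * n - 1))) /\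
  5 * Series1 (fun n => weight q n)
  - 4 * Series1 (fun n => weight q n * inner_sum q n)
  = qpoch_inf q q ^ 2 / qpoch_inf (- q) q ^ 2
    * (3 * Series1 (fun n => INR n * q ^ n / (1 - q ^ n))
       + 2 * Series1 (fun n => INR (2 * n - 1) * q ^ (2 * n - 1)
                               / (1 - q ^ (2 * n - 1)))).
Proof.
  intros q Hq.
  assert (Hs1 : (Cmod 1 <= 1)%R) by (rewrite Cmod_1; lra).
  assert (Hsm1 : (Cmod (- (1)) <= 1)%R) by (rewrite Cmod_m1; lra).
  destruct (qpoch_cv q 1 Hq Hs1) as (c & _ & Hc & _).
  destruct (qpoch_cv q (- (1)) Hq Hsm1) as (d & Hd0 & Hd & Hd').
  rewrite Cmult_1_l in Hc.
  replace (- (1) * q) with (- q) in Hd, Hd' by ring.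
  destruct (ex_series1_geom_bounded _ (geom_bounded_lambert q 1 Hq Hs1))
    as [L HL].
  destruct (ex_series1_geom_bounded _ (geom_bounded_lambert q (- (1)) Hq Hsm1))
    as [L' HL'].
  (* For s = -1 the transformed Lambert term is -q^k / (1 + q^k)^2, so subtracting [L'] contributes
     the terms with denominator (1 + q^k)^2. *)
  assert (HJ : C_cv (full_sum q) (4 * L - L')).
  { apply is_series1_psum, C_cv_lambert in HL, HL'; trivial.
    apply C_cv_ext with (fun n =>
      4 * psum (fun k => 1 * q ^ k / (1 - 1 * q ^ k) ^ 2) n
      - psum (fun k => - (1) * q ^ k / (1 - - (1) * q ^ k) ^ 2) n).
    - intros n. unfold full_sum. rewrite <- psum_scal, <- psum_minus.
      apply psum_ext. intros k. rewrite Cmult_1_l.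
      replace (1 - - (1) * q ^ k) with (1 + q ^ k) by ring.
      unfold Cdiv. ring.
    - apply C_cv_minus; [now apply C_cv_scal | exact HL']. }
  assert (HS : is_series1 (fun n => INR n * q ^ n / (1 - q ^ n)) L).
  { apply is_series1_psum. apply is_series1_psum in HL.
    refine (C_cv_ext _ _ _ _ HL). intros n. apply psum_ext. intros k.
    rewrite Cpow_1_l. now rewrite Cmult_1_r. }
  assert (HO : is_series1 (fun n => INR (2 * n - 1) * q ^ (2 * n - 1)
                       / (1 - q ^ (2 * n - 1))) ((L - L') / 2)).
  { apply (is_series1_odd (fun n => INR n * q ^ n / (1 - q ^ n))); trivial.
    apply is_series1_psum. apply is_series1_psum in HL'.
    refine (C_cv_ext _ _ _ _ HL'). intros n. apply psum_ext. intros k.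
    unfold Cdiv. ring. }
  (* The weight is q^n times the square of a bounded quotient: numerators and reciprocals of
     denominators both converge. *)
  assert (Hweight : geom_bounded (weight q)).
  { destruct (C_cv_bounded _ _ Hc) as [K HK].
    destruct (C_cv_bounded _ _ Hd') as [K' HK'].
    destruct (geom_bounded_mult (fun n => q ^ n)
      (fun n => (qpoch q q (n - 1) * / qpoch (- q) q n) ^ 2) ((K * K') ^ 2))
      as (M & t & Ht & H).
    - intros n. rewrite Cmod_pow, Cmod_mult. apply pow_incr.
      split; [apply Rmult_le_pos; apply Cmod_ge_0|].
      apply Rmult_le_compat; auto using Cmod_ge_0.
    - now apply geom_bounded_pow.
    - exists M, t. split; [exact Ht|]. intros n. specialize (H n).
      replace (weight q n)
        with (q ^ n * (qpoch q q (n - 1) * / qpoch (- q) q n) ^ 2); [exact H|].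
      assert (qpoch (- q) q n <> 0).
      { replace (- q) with (- (1) * q) by ring. now apply qpoch_neq_0. }
      unfold weight. now field. }
  (* The convergent I_n are bounded, and the extra term is q^n times a bounded square, so the second
     series inherits the geometric bound of the weights. *)
  assert (Hinner : exists K, forall n, (Cmod (inner_sum q n) <= K)%R).
  { destruct (C_cv_bounded _ _ HJ) as [K HK].
    destruct (inv_1_minus_scaled_pow_bounded q (- (1)) Hq Hsm1) as [K' HK'].
    exists (K + 1 * (K' * K'))%R. intros n.
    rewrite inner_sum_full_sum by trivial.
    eapply Rle_trans; [apply Cmod_triangle|].
    apply Rplus_le_compat; [apply HK|].
    replace (q ^ n / (1 + q ^ n) ^ 2)
      with (q ^ n * (/ (1 - - (1) * q ^ n) * / (1 - - (1) * q ^ n))).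
    2: { replace (1 - - (1) * q ^ n) with (1 + q ^ n) by ring.
         assert (1 + q ^ n <> 0).
         (* At index 0 the denominator is 2, outside the range of [one_plus_pow_neq_0]. *)
         { destruct n as [|n].
           - simpl. rewrite <- RtoC_plus. intros E%RtoC_inj. lra.
           - apply one_plus_pow_neq_0; trivial. lia. }
         now field. }
    rewrite !Cmod_mult.
    apply Rmult_le_compat; auto using Cmod_ge_0.
    - apply Rmult_le_pos; apply Cmod_ge_0.
    - rewrite Cmod_pow, <- (pow1 n). apply pow_incr.
      split; [apply Cmod_ge_0 | lra].
    - apply Rmult_le_compat; auto using Cmod_ge_0. }
  destruct Hinner as [K HK].
  destruct (ex_series1_geom_bounded _ Hweight) as [S1 HS1].
  destruct (ex_series1_geom_bounded _ (geom_bounded_mult _ _ K HK Hweight))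
    as [S2 HS2].
  split; [now exists S1|]. split; [now exists S2|].
  split; [now exists L|]. split; [now exists ((L - L') / 2)|].
  rewrite (is_series1_unique _ _ HS), (is_series1_unique _ _ HO).
  rewrite (is_series1_unique _ _ HS2), (is_series1_unique (fun n => weight q n) S1 HS1).
  unfold qpoch_inf.
  rewrite (C_lim_seq_unique _ c) by now apply C_cv_filterlim.
  rewrite (C_lim_seq_unique _ d) by now apply C_cv_filterlim.
  apply is_series1_psum in HS1, HS2.
  (* Both sides are limits of P_n I_n: the left by telescoping, the right as a product of limits. *)
  apply C_cv_unique with (fun n => qpoch_ratio q n * full_sum q n).
  - apply C_cv_ext with (fun n => 5 * psum (weight q) n
      - 4 * psum (fun k => weight q k * inner_sum q k) n).
    + intros n. now apply psum_weight_telescope.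
    + now apply C_cv_minus; apply C_cv_scal.
  - replace (c ^ 2 / d ^ 2 * (3 * L + 2 * ((L - L') / 2)))
      with (((c * / d) * (c * / d)) * (4 * L - L')) by now field.
    apply C_cv_ext with (fun n =>
      ((qpoch q q n * / qpoch (- q) q n) * (qpoch q q n * / qpoch (- q) q n))
      * full_sum q n).
    + intros n. unfold qpoch_ratio.
      assert (qpoch (- q) q n <> 0).
      { replace (- q) with (- (1) * q) by ring. now apply qpoch_neq_0. }
      now field.
    + now apply C_cv_mult; [apply C_cv_mult; apply C_cv_mult|].
Qed.
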